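(* Let $k$ be a field of characteristic different from $2$ and let $L/k$ be a finite Galois extension with Galois group $G$. Then the Dress map $h_{L/k}\colon A(G)\to GW(k)$ is surjective if and only if $k$ is quadratically closed in $L$, i.e. every element of $k$ is a square in $L$.
   Context: $A(G)$ is the Burnside ring of the finite group $G$: as an abelian group it is free on the classes $G/H$, with $H$ running over representatives of conjugacy classes of subgroups of $G$; addition is disjoint union and multiplication is cartesian product, with identity $G/G$. $GW(k)$ is the Grothendieck–Witt ring of $k$, generated as an abelian group by the one-dimensional forms $\langle a\rangle$, $a\in k^\times/(k^\times)^2$, with $\langle a\rangle+\langle b\rangle=\langle a,b\rangle$ (orthogonal sum) and $\langle a\rangle\langle b\rangle=\langle ab\rangle$. The Dress map $h_{L/k}$ is the ring homomorphism sending $G/H$ to the trace form $\mathrm{tr}_{L^H/k}\langle 1\rangle_{L^H}$, i.e. the class of the quadratic form $x\mapsto \mathrm{tr}_{L^H/k}(x^2)$ on the $k$-vector space $L^H$. *)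

(* Defs.v *)
From HB Require Import structures.
From mathcomp Require Import all_boot all_order all_algebra all_fingroup all_field.
Set Implicit Arguments. Unset Strict Implicit. Unset Printing Implicit Defensive.
Import GRing.Theory.
Local Open Scope ring_scope.

(* Nondegenerate symmetric bilinear (= quadratic, char <> 2) forms over k,
   represented by their Gram matrices in some basis. *)
Record qform (k : fieldType) := QForm { qdim : nat; qgram : 'M[k]_qdim }.

Definition nondeg (k : fieldType) (q : qform k) : bool :=
  ((qgram q)^T == qgram q) && (qgram q \in unitmx).

Definition isometric (k : fieldType) (q1 q2 : qform k) : Prop :=
  exists P : 'M[k]_(qdim q1, qdim q2),
    [/\ row_free P, row_full P & P^T *m qgram q1 *m P = qgram q2].

Definition qzero (k : fieldType) : qform k := @QForm k 0 0.
Definition qosum (k : fieldType) (q r : qform k) : qform k :=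
  @QForm k (qdim q + qdim r) (block_mx (qgram q) 0 0 (qgram r)).
Definition qosum_seq (k : fieldType) (s : seq (qform k)) : qform k :=
  foldr (@qosum k) (@qzero k) s.

(* GW(k): Grothendieck group of the monoid of isometry classes of
   nondegenerate forms.  An element is a formal difference [a] - [b];
   [a]-[b] = [c]-[d] in GW(k) iff a+d+s ~ c+b+s for some nondegenerate s. *)
Definition GW_eq (k : fieldType) (a b c d : qform k) : Prop :=
  exists s : qform k, nondeg s /\
    isometric (qosum (qosum a d) s) (qosum (qosum c b) s).

(* trace of a k-linear map x |-> a x on a subspace E of L (E stable under a) *)
Definition ftrace (k : fieldType) (L : fieldExtType k) (E : {vspace L}) (a : L) : k :=
  \sum_(i < \dim E) coord (vbasis E) i (a * tnth (vbasis E) i).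

Definition trace_form (k : fieldType) (L : fieldExtType k) (E : {vspace L}) : qform k :=
  @QForm k (\dim E)
    (\matrix_(i < \dim E, j < \dim E) ftrace E (tnth (vbasis E) i * tnth (vbasis E) j)).

(* Dress map on G/H : trace form of L^H over k *)
Definition dress (k : fieldType) (L : splittingFieldType k)
    (H : {group gal_of (fullv : {vspace L})}) : qform k :=
  trace_form (fixedField H).

(* Surjectivity of the Dress map A(G) -> GW(k): every element [q1]-[q2] of GW(k)
   is the image sum_H n_H h(G/H) of some element of A(G); the positive and
   negative parts of the coefficients are encoded as lists of subgroups with
   repetition. *)
Definition dress_surjective (k : fieldType) (L : splittingFieldType k) : Prop :=
  forall q1 q2 : qform k, nondeg q1 -> nondeg q2 ->
    exists sp sm : seq {group gal_of (fullv : {vspace L})},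
      all (fun H : {group gal_of (fullv : {vspace L})} =>
             H \subset 'Gal(fullv / 1%VS)%g) (sp ++ sm) /\
      GW_eq q1 q2 (qosum_seq [seq dress H | H <- sp])
                  (qosum_seq [seq dress H | H <- sm]).

(* Main.v *)
Require Import Defs.
From HB Require Import structures.
From mathcomp Require Import all_boot all_order all_algebra all_fingroup all_field.
From Stdlib Require Import Setoid Morphisms.
Set Implicit Arguments. Unset Strict Implicit. Unset Printing Implicit Defensive.
Import GRing.Theory.
Local Open Scope ring_scope.

(** The determinant of a form, modulo squares, is multiplicative for orthogonal
    sums and hence well defined on GW(k).  If E is the fixed field of H and
    s_1, ..., s_n are the embeddings of E in L, the trace form of E has Gram matrix
    M^T M with M = (s_i(e_j)), so its determinant becomes the square of det M in L.
    Hence, if <a> is in the image of the Dress map, a is a square in L.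

    Conversely, if b = x^2 with x in L and b is not a square in k, the trace form
    of k(x) is <2> + <2b>.  Taking b = 2 puts <2> in the image (<4> = <1>); taking
    b = a / 2 then puts <a> in the image.  Since forms are diagonalizable, the
    image is everything. *)

(** * Isometry, orthogonal sums, and the determinant modulo squares *)

Section Isometry.
Variable k : fieldType.
Implicit Types q r s : qform k.

(** The two dimensions are a priori distinct, so [P] is rectangular; an explicit two-sided inverse
    avoids casts. *)
Lemma isometric_inv q1 q2 (P : 'M[k]_(qdim q1, qdim q2))
    (Q : 'M[k]_(qdim q2, qdim q1)) :
  P *m Q = 1%:M -> Q *m P = 1%:M -> P^T *m qgram q1 *m P = qgram q2 ->
  isometric q1 q2.
Proof.
move=> PQ QP e; exists P; split=> //; first by apply/row_freeP; exists Q.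
by apply/row_fullP; exists Q.
Qed.

Lemma isometricP q1 q2 : isometric q1 q2 ->
  exists P : 'M[k]_(qdim q1, qdim q2), exists Q : 'M[k]_(qdim q2, qdim q1),
    [/\ P *m Q = 1%:M, Q *m P = 1%:M & P^T *m qgram q1 *m P = qgram q2].
Proof.
move=> [P [/row_freeP [Q PQ] /row_fullP [Q' QP] e]].
have QQ' : Q' = Q by rewrite -[Q']mulmx1 -PQ mulmxA QP mul1mx.
by exists P, Q; split; rewrite // -QQ'.
Qed.

Lemma isometric_refl q : isometric q q.
Proof.
by apply: (@isometric_inv _ _ 1%:M 1%:M); rewrite ?trmx1 ?mulmx1 ?mul1mx.
Qed.

#[local] Hint Resolve isometric_refl : core.

Lemma isometric_sym q1 q2 : isometric q1 q2 -> isometric q2 q1.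
Proof.
move=> /isometricP [P [Q [PQ QP e]]]; apply: (isometric_inv QP PQ).
rewrite -e -!mulmxA PQ mulmx1 mulmxA -trmx_mul PQ trmx1 mul1mx //.
Qed.

Lemma isometric_trans q1 q2 q3 :
  isometric q1 q2 -> isometric q2 q3 -> isometric q1 q3.
Proof.
move=> /isometricP [P [Q [PQ QP e]]] /isometricP [P' [Q' [PQ' QP' e']]].
apply: (@isometric_inv _ _ (P *m P') (Q' *m Q)).
- by rewrite mulmxA -(mulmxA P) PQ' mulmx1.
- by rewrite mulmxA -(mulmxA Q') QP mulmx1.
- by rewrite -e' -e trmx_mul !mulmxA.
Qed.

#[global] Instance isometric_equiv : Equivalence (@isometric k).
Proof.
split; [exact: isometric_refl | exact: isometric_sym | exact: isometric_trans].
Qed.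

#[global] Instance qosum_isometric :
  Proper (@isometric k ==> @isometric k ==> @isometric k) (@qosum k).
Proof.
move=> q1 q2 /isometricP [P [Q [PQ QP e]]] r1 r2 /isometricP [P' [Q' [PQ' QP' e']]].
apply: (@isometric_inv (qosum _ _) (qosum _ _) (block_mx P 0 0 P') (block_mx Q 0 0 Q')).
- by rewrite mulmx_block !(mulmx0, mul0mx, addr0, add0r) PQ PQ' -scalar_mx_block.
- by rewrite mulmx_block !(mulmx0, mul0mx, addr0, add0r) QP QP' -scalar_mx_block.
- by rewrite tr_block_mx !trmx0 !mulmx_block !(mulmx0, mul0mx, addr0, add0r) e e'.
Qed.

Lemma qosumC q r : isometric (qosum q r) (qosum r q).
Proof.
apply: (@isometric_inv (qosum _ _) (qosum _ _)
         (block_mx 0 1%:M 1%:M 0) (block_mx 0 1%:M 1%:M 0)).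
- by rewrite mulmx_block !(mulmx0, mul0mx, addr0, add0r, mulmx1) -scalar_mx_block.
- by rewrite mulmx_block !(mulmx0, mul0mx, addr0, add0r, mulmx1) -scalar_mx_block.
- by rewrite tr_block_mx !trmx0 !mulmx_block
    !(mulmx0, mul0mx, addr0, add0r, mulmx1, trmx1, mul1mx).
Qed.

Lemma isometric_cast m n (e : m = n) (A : 'M[k]_m) :
  isometric (QForm A) (QForm (castmx (e, e) A)).
Proof. by case: n / e; rewrite castmx_id. Qed.

(** [block_mxA] identifies the two Gram matrices only up to a cast along [addnA], which is itself an
    isometry. *)
Lemma qosumA q r s : isometric (qosum q (qosum r s)) (qosum (qosum q r) s).
Proof.
have := @block_mxA _ _ _ _ _ _ _ (qgram q) 0 0 0 (qgram r) 0 0 0 (qgram s).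
rewrite !row_mx0 !col_mx0 {1}/qosum /= => ->; apply: isometric_sym.
exact: (isometric_cast (esym (addnA _ _ _)) (qgram (qosum (qosum q r) s))).
Qed.

Lemma qosum0q q : isometric (qosum (qzero k) q) q.
Proof.
exists (1%:M : 'M_(qdim q)); rewrite /= row_free_unit row_full_unit unitmx1.
split=> //; rewrite trmx1; apply/matrixP => i j; rewrite mul1mx mulmx1.
rewrite -(block_mxEdr (0 : 'M_0) 0 0 (qgram q) i j).
by congr (block_mx _ _ _ _ _ _); apply: val_inj.
Qed.

Lemma qosumq0 q : isometric (qosum q (qzero k)) q.
Proof. by rewrite qosumC qosum0q. Qed.

Lemma qosumACA q1 q2 q3 q4 :
  isometric (qosum (qosum q1 q2) (qosum q3 q4)) (qosum (qosum q1 q3) (qosum q2 q4)).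
Proof. by rewrite -!qosumA (qosumA q2) (qosumC q2 q3) -(qosumA q3). Qed.

Lemma qosum_seq_cat (s t : seq (qform k)) :
  isometric (qosum_seq (s ++ t)) (qosum (qosum_seq s) (qosum_seq t)).
Proof.
elim: s => [|q s IH] /=; first by rewrite qosum0q.
by rewrite IH qosumA.
Qed.

Lemma isometric_det q1 q2 : isometric q1 q2 ->
  exists2 c : k, c != 0 & \det (qgram q2) = c ^+ 2 * \det (qgram q1).
Proof.
case: q1 q2 => n1 A [n2 B] /isometricP /= [P [Q [PQ QP e]]].
(* Both products of [P] and [Q] are identities, and their ranks are at most the number of columns of
   the left factor. *)
have nE : n1 = n2.
  apply/eqP; rewrite eqn_leq -{1}(@mxrank1 k n1) -{2}(@mxrank1 k n2) -PQ -QP.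
  by rewrite (leq_trans (mxrankM_maxl _ _)) ?rank_leq_col //
     (leq_trans (mxrankM_maxl _ _)) ?rank_leq_col.
case: n2 / nE in B P Q PQ QP e *; exists (\det P).
  by apply: contra_eq_neq (congr1 determinant PQ) => P0;
    rewrite det_mulmx P0 mul0r det1 eq_sym oner_neq0.
by rewrite -e !det_mulmx det_tr mulrAC expr2.
Qed.

Lemma det_qosum q r : \det (qgram (qosum q r)) = \det (qgram q) * \det (qgram r).
Proof. exact: det_ublock. Qed.

End Isometry.

#[local] Hint Resolve isometric_refl : core.

(** * Diagonalization of nondegenerate symmetric forms *)

Section Diagonalization.
Variable k : fieldType.
Hypothesis char_neq2 : 2%:R != 0 :> k.

Definition qdiag1 (a : k) : qform k := QForm (a%:M : 'M_1).

Lemma isometric_congr n (A P : 'M[k]_n) : P \in unitmx ->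
  isometric (QForm A) (QForm (P^T *m A *m P)).
Proof. by move=> Pu; exists P; rewrite /= row_free_unit row_full_unit. Qed.

Lemma qdiag1_sqr (a c : k) : c != 0 -> isometric (qdiag1 a) (qdiag1 (c ^+ 2 * a)).
Proof.
move=> c0; have := @isometric_congr 1 a%:M c%:M.
rewrite tr_scalar_mx -!scalar_mxM mulrAC -expr2; apply.
by rewrite unitmxE det_scalar1 unitfE.
Qed.

Lemma exists_anisotropic n (A : 'M[k]_n) : A^T = A -> A != 0 ->
  exists v : 'rV_n, v *m A *m v^T != 0.
Proof.
move=> As A0.
(* It suffices to test the vectors e_i + e_j; i = j covers 2 e_i. *)
have [/existsP[v /= nz]|/existsPn all0] :=
   boolP [exists ij : 'I_n * 'I_n,
     (fun v : 'rV_n => v *m A *m v^T != 0) (delta_mx 0 ij.1 + delta_mx 0 ij.2)].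
  by exists (delta_mx 0 v.1 + delta_mx 0 v.2).
case/eqP: A0; apply/matrixP=> i j; rewrite mxE.
have E p q : (delta_mx 0 p : 'rV_n) *m A *m (delta_mx 0 q : 'rV_n)^T = (A p q)%:M.
  by rewrite trmx_delta -rowE -colE; apply/matrixP => x y; rewrite !ord1 !mxE.
have {}all0 p q : A p p + A q q + A p q *+ 2 = 0.
  have := all0 (p, q); rewrite negbK => /eqP /matrixP /(_ 0 0).
  rewrite linearD /= mulmxDl mulmxDl !mulmxDr !E -!raddfD !mxE mulr1n.
  have -> : A q p = A p q by rewrite -{1}As mxE.
  by move=> H; rewrite mulr2n addrACA [A q q + _]addrC.
(* Equal indices give [4 * A p p = 0]; the general relation then reduces to [2 * A i j = 0]. *)
have Z p : A p p = 0.
  have /eqP := all0 p p; rewrite -mulr2n -mulr_natr.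
  rewrite -[A p p + _]mulr2n -[X in X * _]mulr_natr.
  by rewrite !mulf_eq0 (negPf char_neq2) !orbF => /eqP.
have := all0 i j; rewrite !Z !add0r -mulr_natr => /eqP.
by rewrite mulf_eq0 (negPf char_neq2) orbF => /eqP.
Qed.

(** One Gram-Schmidt step: complete an anisotropic vector, up to scaling, to a basis and split off
    its orthogonal complement. *)
Lemma split_diag1 n (A : 'M[k]_n.+1) : nondeg (QForm A) ->
  exists a : k, exists B : 'M_n,
    [/\ a != 0, nondeg (QForm B) & isometric (QForm A) (qosum (qdiag1 a) (QForm B))].
Proof.
rewrite /nondeg /= => /andP[/eqP As Au].
have A0 : A != 0 by apply: contraTneq Au => ->; rewrite unitmxE det0 unitr0.
have [v vA] := exists_anisotropic As A0.
(* As v has rank 1, the first row of row_ebase v is proportional to v. *)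
pose P : 'M_(1 + n) := row_ebase v; pose C : 'M_(1 + n) := P *m A *m P^T.
have Pu : P \in unitmx by exact: row_ebase_unit.
have AC : isometric (QForm A) (QForm C).
  have := @isometric_congr n.+1 A P^T; rewrite trmxK; apply.
  by rewrite unitmx_tr.
have Cs : C^T = C by rewrite /C !trmx_mul trmxK As mulmxA.
have Cu : C \in unitmx by rewrite !unitmx_mul unitmx_tr Pu Au.
pose a := C 0 0.
have a0 : a != 0.
  (* Since [v = w *m P] with [w] supported on the first coordinate, a zero corner of [C] would make
     [v] isotropic. *)
  apply: contra_neq vA => C00; rewrite -[v]mulmx_ebase -/P.
  pose w : 'rV_(1 + n) := col_ebase v *m pid_mx (\rank v).
  have wE : w = w 0 0 *: delta_mx 0 0.
    apply/rowP => j; rewrite !mxE !big_ord1 !mxE.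
    by case: j => [[|j] lj]; rewrite /= ?mulr1 ?mulr0.
  rewrite -/w trmx_mul !mulmxA -(mulmxA w) -(mulmxA w) -/C wE.
  rewrite linearZ /= trmx_delta -!scalemxAl -scalemxAr -rowE -colE.
  move: C00; rewrite /a; generalize C => M M00.
  by apply/matrixP => i j; rewrite !ord1 !mxE M00 !mulr0.
clearbody C; pose u : 'rV_n := ursubmx C.
have CE : C = block_mx (a%:M : 'M_1) u u^T (drsubmx C).
  rewrite -{1}[C]submxK; congr block_mx.
    by apply/matrixP=> i j; rewrite !ord1 !mxE /a; congr (C _ _); apply: val_inj.
  by rewrite /u -{1}Cs trmx_ursub.
(* [Q] subtracts from the other basis vectors their components along the first; [B] is the Schur
   complement of [a] in [C]. *)
pose Q : 'M_(1 + n) := block_mx 1%:M (- a^-1 *: u) 0 1%:M.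
have Qu : Q \in unitmx by rewrite unitmxE det_ublock !det1 mulr1 unitr1.
pose B := drsubmx C - a^-1 *: (u^T *m u).
have QC : Q^T *m C *m Q = block_mx (a%:M : 'M_1) 0 0 B.
  rewrite CE /Q tr_block_mx !trmx1 trmx0 !mulmx_block.
  rewrite !(mulmx0, mul0mx, addr0, add0r, mulmx1, mul1mx).
  have Z : (- a^-1 *: u)^T *m a%:M + u^T = 0.
    by rewrite linearZ /= mul_mx_scalar scalerA mulrN mulfV // scaleN1r addNr.
  have Z' : a%:M *m (- a^-1 *: u) + u = 0 by apply: trmx_inj;
    rewrite linearD /= trmx_mul tr_scalar_mx Z trmx0.
  by rewrite Z Z' mul0mx add0r linearZ /= -scalemxAl scaleNr addrC.
have CB : isometric (QForm C) (QForm (block_mx (a%:M : 'M_1) 0 0 B)).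
  by rewrite -QC; exact: isometric_congr.
exists a, B; split => //; last exact: isometric_trans AC CB.
rewrite /nondeg /=; apply/andP; split.
  by rewrite /B linearB linearZ /= trmx_mul trmxK trmx_drsub Cs.
have : Q^T *m C *m Q \in unitmx by rewrite !unitmx_mul unitmx_tr Qu Cu.
by rewrite QC !unitmxE det_ublock unitrM => /andP[].
Qed.

Lemma diagonal_ind (D : qform k -> Prop) :
  (forall q r, isometric q r -> D q -> D r) ->
  (forall q r, D q -> D r -> D (qosum q r)) ->
  D (qzero k) -> (forall a, a != 0 -> D (qdiag1 a)) ->
  forall q, nondeg q -> D q.
Proof.
move=> Diso Dsum D0 D1 [n A]; elim: n => [|n IH] in A * => nd.
  by rewrite (_ : QForm A = qzero k) // /qzero thinmx0.
have [a [B [a0 ndB AB]]] := split_diag1 nd.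
by apply: Diso (isometric_sym AB) (Dsum _ _ (D1 _ a0) (IH _ ndB)).
Qed.

End Diagonalization.

(** * Trace forms in an arbitrary basis, and those of quadratic extensions *)

Section TraceForm.
Variables (k : fieldType) (L : fieldExtType k).

(** Unlike [ftrace], which is tied to [vbasis E], this allows computing in an explicit basis such as
    [1, x]. *)
Definition btrace n (X : n.-tuple L) (a : L) : k :=
  \sum_(i < n) coord X i (a * X`_i).

Lemma coord_change (E : {vspace L}) m n (X : m.-tuple L) (Y : n.-tuple L) i v :
  basis_of E X -> basis_of E Y -> v \in E ->
  coord X i v = \sum_(j < n) coord X i Y`_j * coord Y j v.
Proof.
move=> bX bY vE; rewrite {1}(coord_basis bY vE) linear_sum /=.
by apply: eq_bigr => j _; rewrite linearZ /= mulrC.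
Qed.

Lemma mem_basis_nth (E : {vspace L}) n (X : n.-tuple L) (i : 'I_n) :
  basis_of E X -> X`_i \in E.
Proof. by move=> bX; rewrite (basis_mem bX) // mem_nth ?size_tuple. Qed.

(** The pattern of tr(ST) = tr(TS): expand in the other basis, exchange the two sums, recombine. *)
Lemma btrace_change (E : {vspace L}) m n (X : m.-tuple L) (Y : n.-tuple L) a :
  basis_of E X -> basis_of E Y -> (forall x, x \in E -> a * x \in E) ->
  btrace X a = btrace Y a.
Proof.
move=> bX bY aE; rewrite /btrace.
under eq_bigr => i _ do rewrite (coord_change _ bX bY (aE _ (mem_basis_nth i bX))).
rewrite exchange_big /=; apply: eq_bigr => j _.
rewrite {2}(coord_basis bX (mem_basis_nth j bY)) mulr_sumr linear_sum /=.
by apply: eq_bigr => i _; rewrite -scalerAr linearZ.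
Qed.

Lemma ftraceE (E : {vspace L}) n (X : n.-tuple L) a :
  basis_of E X -> (forall x, x \in E -> a * x \in E) -> ftrace E a = btrace X a.
Proof.
move=> bX aE; rewrite -(btrace_change (vbasisP E) bX aE).
by apply: eq_bigr => i _; rewrite (tnth_nth 0).
Qed.

Lemma ftrace_sum (E : {vspace L}) (I : finType) (F : I -> L) :
  ftrace E (\sum_i F i) = \sum_i ftrace E (F i).
Proof.
rewrite /ftrace exchange_big /=; apply: eq_bigr => j _.
by rewrite mulr_suml linear_sum.
Qed.

Lemma ftraceZ (E : {vspace L}) c a : ftrace E (c *: a) = c * ftrace E a.
Proof.
by rewrite /ftrace mulr_sumr; apply: eq_bigr => j _; rewrite -scalerAl linearZ.
Qed.

Lemma trace_form_basis (E : {aspace L}) n (X : n.-tuple L) :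
  basis_of E X ->
  isometric (trace_form E) (QForm (\matrix_(i < n, j < n) btrace X (X`_i * X`_j))).
Proof.
move=> bX; have bE := vbasisP E.
have eX i : X`_i = \sum_p coord (vbasis E) p X`_i *: (vbasis E)`_p.
  (* Out of range, the default value [0] makes both sides vanish. *)
  have [ltin|geni] := ltnP i n; last first.
    by rewrite nth_default ?size_tuple // big1 // => p _; rewrite linear0 scale0r.
  exact: (coord_basis bE (mem_basis_nth (Ordinal ltin) bX)).
pose P : 'M[k]_(\dim E, n) := \matrix_(p, i) coord (vbasis E) p X`_i.
pose Q : 'M[k]_(n, \dim E) := \matrix_(i, p) coord X i (vbasis E)`_p.
apply: (@isometric_inv _ (trace_form E) (QForm _) P Q).
- apply/matrixP=> p q; rewrite !mxE eq_sym -(coord_free q p (basis_free bE)).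
  rewrite [RHS](coord_change _ bE bX (mem_basis_nth _ bE)).
  by apply: eq_bigr => i _; rewrite !mxE.
- apply/matrixP=> p q; rewrite !mxE eq_sym -(coord_free q p (basis_free bX)).
  rewrite [RHS](coord_change _ bX bE (mem_basis_nth _ bX)).
  by apply: eq_bigr => i _; rewrite !mxE.
apply/matrixP=> i j; rewrite !mxE -(@ftraceE E) //; last first.
  by move=> x xE; rewrite !memvM ?(mem_basis_nth _ bX).
rewrite {1}(eX i) {1}(eX j) mulr_sumr ftrace_sum.
apply: eq_bigr => q _; rewrite !mxE mulrC -scalerAr ftraceZ; congr (_ * _).
rewrite mulr_suml ftrace_sum; apply: eq_bigr => p _.
by rewrite !mxE -scalerAl ftraceZ !(tnth_nth 0).
Qed.

Lemma trace_form1 : isometric (trace_form (1%AS : {aspace L})) (qdiag1 1).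
Proof.
pose X : 1.-tuple L := [tuple 1].
have bX : basis_of (1%AS : {aspace L}) X.
  by rewrite basisEdim span_seq1 dimv1 subvv.
etransitivity; first exact: (trace_form_basis bX).
rewrite /qdiag1 (_ : (\matrix_(_, _) _) = 1%:M) //.
apply/matrixP => i j; rewrite !ord1 !mxE /btrace big_ord1 !mul1r.
by rewrite (coord_free 0 0 (basis_free bX)).
Qed.

(** The traces of [1], [x] and [x ^+ 2] are [2], [0] and [2 * a], so the basis [1, x] is
    orthogonal. *)
Lemma trace_form_quadratic (a : k) (x : L) : x ^+ 2 = a%:A -> x \notin 1%VS ->
  isometric (trace_form <<1; x>>%AS) (qosum (qdiag1 2%:R) (qdiag1 (2%:R * a))).
Proof.
move=> xa x1; pose X : 2.-tuple L := [tuple 1; x].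
have fX : free X.
  rewrite (@perm_free _ _ _ [:: x; 1]) ?(perm_catC [:: 1] [:: x]) //.
  by rewrite free_cons seq1_free oner_neq0 span_seq1 andbT.
have XE : (<<X>> <= <<1; x>>%AS)%VS.
  by apply/span_subvP => y; rewrite !inE => /orP[]/eqP->; rewrite ?mem1v ?memv_adjoin.
have bX : basis_of <<1; x>>%AS X.
  (* It remains to bound the degree of [x] by 2; sizes exceed degrees by one, and ['X^2 - a] has
     size 3. *)
  rewrite basisEfree fX XE /= dim_Fadjoin dimv1 muln1 -ltnS -size_minPoly.
  have pE : 'X^2 - (a%:A)%:P != 0 :> {poly L}.
    by rewrite -size_poly_gt0 size_XnsubC.
  rewrite -(size_XnsubC (a%:A : L) (isT : 0 < 2)%N); apply: dvdp_leq => //.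
  apply: minPoly_dvdp; last by rewrite /root !hornerE xa subrr.
  by rewrite rpredB ?rpredX ?polyOverX ?polyOverC ?rpredZ ?mem1v.
have t1 : btrace X 1 = 2%:R.
  rewrite /btrace big_ord_recl big_ord1 !mul1r !(coord_free _ _ fX) !eqxx.
  by rewrite -natrD.
have tx : btrace X x = 0.
  rewrite /btrace big_ord_recl big_ord1 /= mulr1 -expr2 xa linearZ /=.
  rewrite (coord_free (lift ord0 ord0) ord0 fX) (coord_free ord0 (lift ord0 ord0) fX).
  by rewrite mulr0 addr0.
have ta : btrace X (x * x) = 2%:R * a.
  rewrite -expr2 xa -t1 mulrC /btrace mulr_sumr; apply: eq_bigr => i _.
  by rewrite -scalerAl linearZ.
etransitivity; first exact: (trace_form_basis bX).
rewrite /qosum /qdiag1 /=.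
rewrite (_ : (\matrix_(_, _) _) =
  block_mx (2%:R)%:M 0 0 ((2%:R * a)%:M : 'M_1) :> 'M_(1 + 1)) //.
apply/matrixP => i j.
case: (split_ordP i) => i' ->; case: (split_ordP j) => j' ->; rewrite !ord1.
- by rewrite block_mxEul !mxE /= mul1r t1.
- by rewrite block_mxEur !mxE /= mul1r tx.
- by rewrite block_mxEdl !mxE /= mulr1 tx.
- by rewrite block_mxEdr !mxE /= ta.
Qed.

End TraceForm.

(** * Determinants of trace forms are squares in [L] *)

Section Discriminant.
Variables (k : fieldType) (L : splittingFieldType k).
Local Notation G := 'Gal(fullv / (1%VS : {vspace L}))%g.
Hypothesis galL : galois 1%VS (fullv : {vspace L}).

(** If [v] were nonzero, taking [c = a / v] would make the sum of all automorphisms vanish at every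
    [a], against their linear independence. *)
Lemma trace_nondeg (v : L) : (forall c, galTrace 1%AS fullv (c * v) = 0) -> v = 0.
Proof.
move=> tr0; apply/eqP; apply: contraT => v0.
have /(_ (fun=> 1) _ 1%g (group1 _))/eqP := @gal_independent _ _ fullv (mem G).
rewrite oner_eq0; apply=> a _.
under eq_bigr do rewrite mul1r.
by rewrite -[RHS](tr0 (a / v)) divfK.
Qed.

Section Embeddings.
Variable H : {group gal_of (fullv : {vspace L})}.
Hypothesis sHG : H \subset G.
Local Notation E := (fixedField H).
Local Notation e := (vbasis E).

(** Elements of one right coset of [H] agree on [E], since [h * g] sends [x] to [g (h x) = g x];
    there are [\dim E] such cosets. *)
Lemma fixedField_embeddings :
  exists s : 'I_(\dim E) -> gal_of (fullv : {vspace L}),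
  forall g, g \in G -> exists i, {in E, g =1 s i}.
Proof.
have nE : #|rcosets H G| = \dim E.
  by have := dim_fixed_galois galL sHG; rewrite dimv1 divn1.
exists (fun i => repr (enum_val (cast_ord (esym nE) i))) => g gG.
have gR : (H :* g)%g \in rcosets H G by rewrite mem_rcosets mulSGid.
exists (cast_ord nE (enum_rank_in gR (H :* g)%g)) => x xE.
rewrite cast_ordK enum_rankK_in //; case: repr_rcosetP => h hH.
by rewrite galM ?memvf // (mem_fixedFieldP xE).2.
Qed.

Lemma det_dress :
  exists2 d : L, d != 0 & d ^+ 2 = (\det (qgram (dress H)))%:A.
Proof.
have [s sP] := fixedField_embeddings.
have bE := vbasisP E.
pose M := \matrix_(i < \dim E, j < \dim E) s i e`_j.
(* If M v = 0 then \sum_j e_j Tr (c v_j) = 0 for every c, so Tr (c v_j) = 0 for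
   every c and v = 0 by independence of characters. *)
have Mu : M \in unitmx.
  rewrite -unitmx_tr -row_free_unit; apply/inj_row_free => v vM.
  have Gv g : g \in G -> \sum_(j < \dim E) g e`_j * v 0 j = 0.
    move=> /sP [i gi]; have /rowP/(_ i) := vM; rewrite !mxE => vMi.
    rewrite -[RHS]vMi; apply: eq_bigr => j _.
    by rewrite !mxE mulrC gi // (mem_basis_nth _ bE).
  apply/rowP=> j; rewrite mxE; apply: trace_nondeg => c.
  have trE (a : L) : exists t : k, galTrace 1%AS fullv a = t%:A.
    exact/vlineP/(mem_galTrace galL (memvf a)).
  have tr0 : \sum_(j < \dim E) e`_j * galTrace 1%AS fullv (c * v 0 j) = 0.
    under eq_bigr do rewrite mulr_sumr.
    rewrite exchange_big big1 //= => g gG.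
    have gV (x : L) : g (g^-1%g x) = x by rewrite -galM ?memvf // mulVg gal_id.
    (* Pulling [g] out of the sum leaves the relation [Gv] at [g^-1]. *)
    transitivity (g (c * \sum_(j < \dim E) g^-1%g e`_j * v 0 j)); last first.
      by rewrite Gv ?groupV // mulr0 rmorph0.
    rewrite mulr_sumr rmorph_sum.
    by apply: eq_bigr => i _; rewrite mulrCA [RHS]rmorphM /= gV.
  (* The traces lie in [k], so [tr0] is a [k]-linear relation between basis vectors of [E]. *)
  have [t tP] := fin_all_exists (fun j => trE (c * v 0 j)).
  have /freeP freeE := basis_free bE.
  rewrite tP (freeE t) ?scale0r // -[RHS]tr0.
  by apply: eq_bigr => i _; rewrite tP -scalerAr mulr1.
(* M conjugates multiplication by a into diag (s_i a). *)
have trE a : a \in E -> (ftrace E a)%:A = \sum_i s i a.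
  move=> aE; pose A : 'M[k]_(\dim E) := \matrix_(j, p) coord e p (a * e`_j).
  pose D : 'rV[L]_(\dim E) := \row_i s i a.
  have MA : M *m (map_mx (in_alg L) A)^T = diag_mx D *m M.
    apply/matrixP => i j; rewrite mul_diag_mx !mxE -rmorphM /=.
    rewrite [in RHS](coord_basis bE (_ : a * e`_j \in E)) ?memvM
      ?(mem_basis_nth _ bE) //.
    rewrite rmorph_sum; apply: eq_bigr => p _.
    by rewrite !mxE /= linearZ /= -scalerAr mulr1.
  transitivity (\tr (diag_mx D)); last first.
    by rewrite mxtrace_diag; apply: eq_bigr => i _; rewrite mxE.
  rewrite -[diag_mx D](mulmxK Mu) -MA mxtrace_mulC mulmxA mulVmx // mul1mx mxtrace_tr.
  rewrite trace_map_mx /ftrace /mxtrace /=; congr (_ %:A); apply: eq_bigr => i _.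
  by rewrite mxE (tnth_nth 0).
exists (\det M); first by rewrite -unitfE -unitmxE.
(* Entry [(i, j)] of [M^T *m M] is the sum over [p] of [s p] applied to the product of basis vectors
   [i] and [j], which is its trace by [trE]. *)
rewrite -[RHS]/(in_alg L _) -det_map_mx expr2 -{1}det_tr -det_mulmx; congr (\det _).
apply/matrixP => i j; rewrite !mxE /= !(tnth_nth 0) trE.
  by apply: eq_bigr => p _; rewrite !mxE rmorphM.
by rewrite memvM ?(mem_basis_nth _ bE).
Qed.

End Embeddings.

Lemma det_dress_sum (t : seq {group gal_of (fullv : {vspace L})}) :
  all (fun H : {group _} => H \subset G) t ->
  exists2 d : L, d != 0 &
    d ^+ 2 = (\det (qgram (qosum_seq [seq dress H | H <- t])))%:A.
Proof.
elim: t => [_|H t IH /= /andP[sH /IH [d d0 dE]]].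
  by exists 1; rewrite ?oner_eq0 //= det_mx00 expr1n scale1r.
have [c c0 cE] := det_dress sH; exists (c * d); first by rewrite mulf_neq0.
by rewrite exprMn cE dE (det_qosum (dress H)) -(rmorphM (in_alg L)).
Qed.

(** Determinants are compared in an expression of [<a>] minus the zero form; [a = 0] is treated
    apart because [<0>] is degenerate. *)
Lemma dress_surjective_square (a : k) :
  dress_surjective L -> exists x : L, x ^+ 2 = a%:A.
Proof.
have [-> _|a0 surj] := eqVneq a 0; first by exists 0; rewrite expr0n scale0r.
have nda : nondeg (qdiag1 a).
  by rewrite /nondeg /= tr_scalar_mx eqxx unitmxE det_scalar1 unitfE.
have nd0 : nondeg (qzero k) by rewrite /nondeg /= trmx0 eqxx unitmxE det_mx00 unitr1.
have [sp [sm [+ [s [nds /isometric_det [c c0]]]]]] := surj _ _ nda nd0.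
rewrite all_cat => /andP[/det_dress_sum [x x0 xE] /det_dress_sum [y y0 yE]].
rewrite !det_qosum [\det (qgram (qdiag1 a))]det_scalar1.
rewrite [\det (qgram (qzero k))]det_mx00 mulr1 mulrA.
move: nds => /andP[_]; rewrite unitmxE unitfE => s0 /(mulIf s0) e.
have cy0 : c%:A * y != 0 by rewrite mulf_neq0 // scaler_eq0 oner_eq0 orbF.
(* Cancelling the determinant of [s] has left [x ^+ 2 = c ^+ 2 * a * y ^+ 2] in [L]. *)
exists (x / (c%:A * y)); apply: (mulIf (expf_neq0 2 cy0)).
rewrite -exprMn divfK // xE e exprMn yE.
by rewrite -!(rmorphXn (in_alg L)) -!(rmorphM (in_alg L)) /= mulrCA.
Qed.

End Discriminant.

(** * Closure properties of the Dress image, and surjectivity *)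

Section DressImage.
Variables (k : fieldType) (L : splittingFieldType k).
Local Notation grp := {group gal_of (fullv : {vspace L})}.
Local Notation G := 'Gal(fullv / (1%VS : {vspace L}))%g.
Hypothesis galL : galois 1%VS (fullv : {vspace L}).

Definition dress_sum (t : seq grp) : qform k := qosum_seq [seq dress H | H <- t].

Definition subgal (t : seq grp) : bool := all (fun H : grp => H \subset G) t.

Lemma dress_sum_cat t u :
  isometric (dress_sum (t ++ u)) (qosum (dress_sum t) (dress_sum u)).
Proof. by rewrite /dress_sum map_cat qosum_seq_cat. Qed.

(** A genuine isometry, stronger than equality in GW; closure properties follow by rearranging
    summands. *)
Definition in_dress_image (q : qform k) : Prop := exists sp sm : seq grp,
  [/\ subgal sp, subgal sm & isometric (qosum q (dress_sum sm)) (dress_sum sp)].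

Lemma in_dress_image_isometric q r :
  isometric q r -> in_dress_image q -> in_dress_image r.
Proof.
move=> qr [sp [sm [Gp Gm e]]]; exists sp, sm; split=> //.
by rewrite -qr.
Qed.

Lemma in_dress_image_sum q r :
  in_dress_image q -> in_dress_image r -> in_dress_image (qosum q r).
Proof.
move=> [sp [sm [Gp Gm e]]] [tp [tm [Hp Hm f]]]; exists (sp ++ tp), (sm ++ tm).
split; rewrite /subgal ?all_cat ?[all _ _]Gp ?[all _ _]Gm //.
by rewrite !dress_sum_cat qosumACA e f.
Qed.

(** No Witt cancellation is involved: replacing [tp] by [r + tm] in [q + sm + tp] makes [q + r + sm]
    appear, which is [sp]. *)
Lemma in_dress_image_diff q r :
  in_dress_image (qosum q r) -> in_dress_image r -> in_dress_image q.
Proof.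
move=> [sp [sm [Gp Gm e]]] [tp [tm [Hp Hm f]]]; exists (sp ++ tm), (sm ++ tp).
split; rewrite /subgal ?all_cat ?[all _ _]Gp ?[all _ _]Gm //.
by rewrite !dress_sum_cat -e -f -!qosumA (qosumA (dress_sum sm) r)
  (qosumC (dress_sum sm) r) -qosumA.
Qed.

Lemma in_dress_image_dress (H : grp) : H \subset G -> in_dress_image (dress H).
Proof.
move=> sH; exists [:: H], [::].
by split; rewrite /subgal //= sH.
Qed.

(** By the Galois correspondence, [E] is the fixed field of ['Gal(fullv / E)]. *)
Lemma in_dress_image_trace_form (E : {subfield L}) : in_dress_image (trace_form E).
Proof.
have galE : galois E (fullv : {vspace L}).
  by apply: galoisS galL; rewrite sub1v subvf.
have := @in_dress_image_dress 'Gal(fullv / E)%G; rewrite /dress /=.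
by rewrite (galois_fixedField galE); apply; rewrite galS // sub1v.
Qed.

Lemma in_dress_image0 : in_dress_image (qzero k).
Proof. by exists [::], [::]; split=> //; rewrite qosum0q. Qed.

Lemma dress_surjective_image :
  (forall q, nondeg q -> in_dress_image q) -> dress_surjective L.
Proof.
move=> all_in q r /all_in [sp [sm [Gp Gm e]]] /all_in [tp [tm [Hp Hm f]]].
(* From [q + sm = sp] and [r + tm = tp] one gets [[q] - [r] = [sp + tm] - [sm + tp]]. *)
exists (sp ++ tm), (sm ++ tp); split.
  by rewrite !all_cat [all _ sp]Gp [all _ sm]Gm [all _ tp]Hp [all _ tm]Hm.
exists (qzero k); split.
  by rewrite /nondeg /= trmx0 eqxx unitmxE det_mx00 unitr1.
rewrite -!/(dress_sum _) !qosumq0 !dress_sum_cat -e -f.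
by rewrite qosumA -!qosumA (qosumC (dress_sum tm)).
Qed.

Hypothesis char_neq2 : 2%:R != 0 :> k.
Hypothesis sqrL : forall a : k, exists x : L, x ^+ 2 = a%:A.

Lemma in_dress_image_2_2a (a : k) : (forall c : k, c ^+ 2 != a) ->
  in_dress_image (qosum (qdiag1 2%:R) (qdiag1 (2%:R * a))).
Proof.
move=> nsq; have [x xa] := sqrL a.
apply: in_dress_image_isometric (in_dress_image_trace_form <<1; x>>%AS).
apply: trace_form_quadratic => //; apply/negP=> /vlineP[c xc].
have /negP[] := nsq c; apply/eqP; apply: (fmorph_inj (in_alg L)).
by rewrite rmorphXn /= -xc.
Qed.

(** Being a square in [k] is decided through [L]: the roots there are [x] and [-x], and membership
    of [x] in [1%VS] is decidable. *)
Lemma square_or_not (a : k) :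
  (exists c : k, c ^+ 2 = a) \/ (forall c : k, c ^+ 2 != a).
Proof.
have [x xa] := sqrL a.
have [/vlineP[c xc]|x1] := boolP (x \in 1%VS).
  left; exists c; apply: (fmorph_inj (in_alg L)).
  by rewrite rmorphXn /= -xc.
right=> c; apply: contra x1 => /eqP ca.
have : x ^+ 2 == (c%:A) ^+ 2 by rewrite xa -ca -(rmorphXn (in_alg L)).
by rewrite eqf_sqr => /orP[]/eqP->; rewrite ?rpredN rpredZ ?mem1v.
Qed.

Lemma in_dress_image_qdiag1_1 : in_dress_image (qdiag1 1).
Proof.
exact: in_dress_image_isometric (@trace_form1 _ _) (in_dress_image_trace_form _).
Qed.

Lemma in_dress_image_qdiag1_sqr (c : k) : c != 0 -> in_dress_image (qdiag1 (c ^+ 2)).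
Proof.
move=> c0; apply: in_dress_image_isometric in_dress_image_qdiag1_1.
by rewrite -[c ^+ 2]mulr1; apply: qdiag1_sqr.
Qed.

Lemma in_dress_image_qdiag1_2 : in_dress_image (qdiag1 2%:R).
Proof.
have [[c c2]|/in_dress_image_2_2a D] := square_or_not 2%:R.
  rewrite -c2; apply: in_dress_image_qdiag1_sqr.
  by apply: contraNneq char_neq2 => c0; rewrite -c2 c0 expr0n.
by apply: in_dress_image_diff D _; apply: in_dress_image_qdiag1_sqr.
Qed.

(** If [a / 2] is a square in [k], then [<a> = <2>]; otherwise [<2>] is subtracted from
    [<2> + <a>]. *)
Lemma in_dress_image_qdiag1 (a : k) : a != 0 -> in_dress_image (qdiag1 a).
Proof.
move=> a0; rewrite -[a](divfK char_neq2) mulrC.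
have [[c cE]|/in_dress_image_2_2a D] := square_or_not (a / 2%:R).
  apply: in_dress_image_isometric in_dress_image_qdiag1_2.
  rewrite -cE mulrC; apply: qdiag1_sqr.
  by apply: contraNneq a0 => c0; rewrite -[a](divfK char_neq2) -cE c0 expr0n mul0r.
apply: in_dress_image_diff in_dress_image_qdiag1_2.
by apply: in_dress_image_isometric D; apply: qosumC.
Qed.

Lemma square_dress_surjective : dress_surjective L.
Proof.
apply: dress_surjective_image; apply: diagonal_ind => //.
- exact: in_dress_image_isometric.
- exact: in_dress_image_sum.
- exact: in_dress_image0.
- exact: in_dress_image_qdiag1.
Qed.

End DressImage.

Theorem theorem1p3 (k : fieldType) (L : splittingFieldType k) :
  ~~ (2%N \in [pchar k]) ->
  galois 1%VS (fullv : {vspace L}) ->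
  (dress_surjective L <-> forall a : k, exists x : L, x ^+ 2 = a%:A).
Proof.
rewrite inE /= => char_neq2 galL; split=> [surj a|].
  exact: dress_surjective_square.
exact: square_dress_surjective.
Qed.
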